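(* Let $f(x), g(x)\in\mathbb{Z}[x]$ with $g(x)\neq 0$. Then there exist unique $P(x), r(x)\in R$ such that $$f(x)=P(x)g(x)+r(x)\quad\text{where}\quad 0\preccurlyeq r(x)\prec |g(x)|.$$
   Context: An integer-valued quasi-polynomial is a function $f:\mathbb{Z}\to\mathbb{Z}$ for which there exist a positive integer $T$ and polynomials $f_0,\dots,f_{T-1}\in\mathbb{Z}[x]$ such that $f(Tm+i)=f_i(m)$ for all $m\in\mathbb{Z}$ and $0\le i\le T-1$; one then writes $f=(T,\{f_i\}_{i=0}^{T-1})$ and calls this a representation of $f$. $R$ denotes the set of all integer-valued quasi-polynomials with pointwise addition and multiplication (a commutative ring with identity); a polynomial in $\mathbb{Z}[x]$ is regarded as an element of $R$ via evaluation on $\mathbb{Z}$. For $r\in R$ with representation $(T,\{r_i\}_{i=0}^{T-1})$: $r\succcurlyeq 0$ means that for every $i$, $r_i=0$ or the leading coefficient of $r_i$ is positive (equivalently, there is $C\in\mathbb{Z}$ with $r(n)\ge 0$ for all integers $n>C$); $r\succ 0$ means that for every $i$, $r_i\ne 0$ and its leading coefficient is positive. These conditions do not depend on the representation. Write $f\preccurlyeq g$ if $g-f\succcurlyeq 0$, and $f\prec g$ if $g-f\succ 0$. For $g\in\mathbb{Z}[x]$, $|g|$ is the polynomial equal to $g$ if $g\succ 0$, to $-g$ if $g\prec 0$, and to $0$ if $g=0$. *)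

(* Defs.v *)
From HB Require Import structures.
From mathcomp Require Import all_boot all_order all_algebra.
From mathcomp Require Import boolp functions.
From mathcomp Require Import ring.

Set Implicit Arguments.
Unset Strict Implicit.
Unset Printing Implicit Defensive.

Import Order.TTheory GRing.Theory Num.Theory.
Local Open Scope ring_scope.

Definition represents (T : nat) (F : 'I_T -> {poly int}) (f : int -> int) :=
  (0 < T)%N /\ forall (m : int) (i : 'I_T), f (T%:Z * m + i%:Z) = (F i).[m].

Definition is_quasi_poly (f : int -> int) : Prop :=
  exists (T : nat) (F : 'I_T -> {poly int}), represents F f.

Definition quasi_poly_pred : {pred int -> int} := fun f => `[< is_quasi_poly f >].

Lemma index_split (T k i : nat) (m : int) :
  (k * T)%N%:Z * m + i%:Z =
  T%:Z * (k%:Z * m + (i %/ T)%N%:Z) + (i %% T)%N%:Z.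
Proof. by rewrite {1}(divn_eq i T) PoszD !PoszM; ring. Qed.

Lemma represents_refine T (F : 'I_T -> {poly int}) f T' :
  represents F f -> (0 < T')%N -> (T %| T')%N ->
  exists G : 'I_T' -> {poly int}, represents G f.
Proof.
move=> [T0 Ff] T'0 /dvdnP[k defT'].
exists (fun i => F (Ordinal (ltn_pmod i T0)) \Po (k%:Z *: 'X + (i %/ T)%N%:Z%:P)).
split=> // m i; rewrite horner_comp !hornerE -Ff /=.
by rewrite -index_split -defT'.
Qed.

Lemma quasi_poly_common f g : is_quasi_poly f -> is_quasi_poly g ->
  exists (T : nat) (F G : 'I_T -> {poly int}), represents F f /\ represents G g.
Proof.
move=> [T1 [F Ff]] [T2 [G Gg]].
have T0 : (0 < T1 * T2)%N by rewrite muln_gt0 Ff.1 Gg.1.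
have [F' F'f] := represents_refine Ff T0 (dvdn_mulr T2 (dvdnn T1)).
have [G' G'g] := represents_refine Gg T0 (dvdn_mull T1 (dvdnn T2)).
by exists (T1 * T2)%N, F', G'.
Qed.

Lemma horner_is_quasi_poly (p : {poly int}) : is_quasi_poly (fun n => p.[n]).
Proof.
exists 1%N, (fun=> p); split=> // m i.
by rewrite ord1 mul1r addr0.
Qed.

Lemma quasi_poly_subring : subring_closed quasi_poly_pred.
Proof.
split=> [|f g /asboolP fQ /asboolP gQ|f g /asboolP fQ /asboolP gQ]; apply/asboolP.
- have [T [F [T0 Ff]]] := horner_is_quasi_poly 1.
  by exists T, F; split=> // m i; rewrite -Ff hornerE.
- have [T [F [G [[T0 Ff] [_ Gg]]]]] := quasi_poly_common fQ gQ.
  by exists T, (fun i => F i - G i); split=> // m i; rewrite !hornerE -Ff -Gg.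
- have [T [F [G [[T0 Ff] [_ Gg]]]]] := quasi_poly_common fQ gQ.
  by exists T, (fun i => F i * G i); split=> // m i; rewrite hornerM -Ff -Gg.
Qed.

HB.instance Definition _ :=
  GRing.isSubringClosed.Build (int -> int) quasi_poly_pred quasi_poly_subring.

Record quasipoly : Type :=
  QuasiPoly { quasipoly_fun :> int -> int; _ : quasipoly_fun \in quasi_poly_pred }.

HB.instance Definition _ := [isSub for quasipoly_fun].
HB.instance Definition _ := [Choice of quasipoly by <:].
HB.instance Definition _ :=
  GRing.SubChoice_isSubComPzRing.Build _ _ quasipoly quasi_poly_subring.

(* The ring structure inherited from [int -> int] is the pointwise one. *)
Lemma quasipolyD (f g : quasipoly) (n : int) : (f + g) n = f n + g n.
Proof. by []. Qed.

Lemma quasipolyM (f g : quasipoly) (n : int) : (f * g) n = f n * g n.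
Proof. by []. Qed.

Lemma quasipolyP (f g : quasipoly) : f =1 g <-> f = g.
Proof. by split=> [/funext eq_fg|-> //]; apply/val_inj. Qed.

Definition quasipoly_of_poly (p : {poly int}) : quasipoly :=
  QuasiPoly (asboolT (horner_is_quasi_poly p)).

Notation "p %:QP" := (quasipoly_of_poly p) (at level 2, format "p %:QP") : ring_scope.

(* Quantifying over all representations agrees with using any single one; see
   [qge0_rep] and [qgt0_rep] below. *)
Definition qge0 (r : quasipoly) : Prop :=
  forall (T : nat) (F : 'I_T -> {poly int}), represents F r ->
  forall i : 'I_T, F i = 0 \/ 0 < lead_coef (F i).

Definition qgt0 (r : quasipoly) : Prop :=
  forall (T : nat) (F : 'I_T -> {poly int}), represents F r ->
  forall i : 'I_T, F i != 0 /\ 0 < lead_coef (F i).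

Definition qle (f g : quasipoly) : Prop := qge0 (g - f).
Definition qlt (f g : quasipoly) : Prop := qgt0 (g - f).

Definition poly_abs (g : {poly int}) : {poly int} :=
  if `[< qlt 0 g%:QP >] then g else if `[< qlt g%:QP 0 >] then - g else 0.

Lemma poly_int_inj (p q : {poly int}) : (forall n : int, p.[n] = q.[n]) -> p = q.
Proof.
move=> eq_pq; apply/eqP; rewrite -subr_eq0; apply/eqP.
apply: (@roots_geq_poly_eq0 _ _ [seq k%:Z | k <- iota 0 (size (p - q))]).
- by apply/allP=> n _; rewrite rootE !hornerE eq_pq subrr.
- by rewrite map_inj_uniq ?iota_uniq // => a b [].
- by rewrite size_map size_iota.
Qed.

Lemma lead_coef_comp_affine (p : {poly int}) (k : nat) (c : int) : (0 < k)%N ->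
  (lead_coef (p \Po (k%:Z *: 'X + c%:P)) == 0) = (lead_coef p == 0) /\
  (0 < lead_coef (p \Po (k%:Z *: 'X + c%:P))) = (0 < lead_coef p).
Proof.
move=> k0; have kN0 : k%:Z != 0 by rewrite eqz_nat -lt0n.
have sX : size (k%:Z *: 'X : {poly int}) = 2%N by rewrite size_scale ?size_polyX.
have sC : (size (c%:P : {poly int}) < 2)%N by rewrite (leq_ltn_trans (size_polyC_leq1 c)).
rewrite lead_coef_comp ?size_polyDl ?sX // lead_coefDl ?sX //.
rewrite lead_coefZ lead_coefX mulr1; split.
  by rewrite mulf_eq0 expf_eq0 (negbTE kN0) andbF orbF.
by rewrite pmulr_lgt0 // exprn_gt0 // ltz_nat.
Qed.

Lemma represents_lead_coef T1 (F : 'I_T1 -> {poly int}) T2 (G : 'I_T2 -> {poly int}) f :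
  represents F f -> represents G f -> forall i : 'I_T1, exists j : 'I_T2,
  (lead_coef (F i) == 0) = (lead_coef (G j) == 0) /\
  (0 < lead_coef (F i)) = (0 < lead_coef (G j)).
Proof.
move=> [T10 Ff] [T20 Gf] i; exists (Ordinal (ltn_pmod i T20)).
set j := Ordinal _.
have eqFG : F i \Po (T2%:Z *: 'X + 0%:P) = G j \Po (T1%:Z *: 'X + (i %/ T2)%N%:Z%:P).
  apply: poly_int_inj => n; rewrite !horner_comp -Ff -Gf !hornerE /=.
  rewrite -index_split PoszM; congr f; ring.
have [e1 e2] := lead_coef_comp_affine (F i) 0 T20.
have [e3 e4] := lead_coef_comp_affine (G j) (i %/ T2)%N%:Z T10.
by rewrite -e1 -e2 -e3 -e4 eqFG.
Qed.

Lemma qge0_rep (r : quasipoly) T (F : 'I_T -> {poly int}) : represents F r ->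
  qge0 r <-> forall i, F i = 0 \/ 0 < lead_coef (F i).
Proof.
move=> Fr; split=> [|F_ge0 T' G Gr i]; first exact.
have [j [e1 e2]] := represents_lead_coef Gr Fr i.
case: (F_ge0 j) => [Fj0|Fj_gt0]; [left|by right; rewrite e2].
by apply/eqP; rewrite -lead_coef_eq0 e1 lead_coef_eq0 Fj0.
Qed.

Lemma qgt0_rep (r : quasipoly) T (F : 'I_T -> {poly int}) : represents F r ->
  qgt0 r <-> forall i, F i != 0 /\ 0 < lead_coef (F i).
Proof.
move=> Fr; split=> [|F_gt0 T' G Gr i]; first exact.
have [j [e1 e2]] := represents_lead_coef Gr Fr i.
have [FjN0 Fj_gt0] := F_gt0 j.
by rewrite -lead_coef_eq0 e1 lead_coef_eq0 e2.
Qed.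

Lemma qgt0_poly (p : {poly int}) : qgt0 p%:QP <-> 0 < lead_coef p.
Proof.
have p_rep : represents (fun _ : 'I_1 => p) p%:QP.
  by split=> // m i; rewrite ord1 mul1r addr0.
rewrite (qgt0_rep p_rep); split=> [/(_ ord0)[]|p_gt0 _] //; split=> //.
by rewrite -lead_coef_eq0 gt_eqF.
Qed.

Lemma poly_absE (g : {poly int}) : poly_abs g = sgz (lead_coef g) *: g.
Proof.
have qN : 0 - g%:QP = (- g)%:QP by apply/quasipolyP => n /=; rewrite hornerN sub0r.
rewrite /poly_abs /qlt subr0 qN.
case: asboolP => [/qgt0_poly g_gt0|/qgt0_poly/negP g_ngt0].
  by rewrite gtr0_sgz // scale1r.
case: asboolP => [/qgt0_poly|/qgt0_poly/negP]; rewrite lead_coefN oppr_gt0.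
  by move=> g_lt0; rewrite ltr0_sgz // scaleN1r.
move: g_ngt0; rewrite -!leNgt => g_le0 g_ge0.
have /eqP : lead_coef g = 0 by apply/le_anti/andP.
by rewrite lead_coef_eq0 => /eqP ->; rewrite scaler0.
Qed.

(* Main.v *)
Require Import Defs.
From mathcomp Require Import all_boot all_order all_algebra.
From mathcomp Require Import boolp functions.
From mathcomp Require Import ring zify.

Import Order.TTheory GRing.Theory Num.Theory.
Local Open Scope ring_scope.

(** The order on quasi-polynomials is the order of their values at all large
    integers ([qge0_eventually], [qgt0_eventually]), so both halves of the
    theorem can be argued pointwise.  Write [h] for [|g|], whose leading
    coefficient is positive.

    Existence.  Pseudo-division by [h] gives [T f = q h + rho] with [T] a power
    of the leading coefficient of [h] and [deg rho < deg h].  Dividing the value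
    [q n] by [T], as [q n = T P n + c n], gives
    [T (f n - P n h n) = c n h n + rho n].  For large [n] the value [rho n] is
    negligible against [h n], so for [0 <= c n <= T] the right-hand side is at
    least [0] and less than [T h n], unless [c n] is [0] or [T] and [rho n] has
    the wrong sign ([digit_bound]).  That exception is avoided by taking
    [0 <= c n < T] when [rho] is not eventually negative and [0 < c n <= T] when
    it is.  The quotient [P] is a quasi-polynomial of period [T], because [q]
    modulo [T] is periodic of period [T] ([is_quasi_poly_divz]).

    Uniqueness.  Two remainders differ, at large [n], by less than [h n] and by a
    multiple of [h n]; hence the quotients agree at all large [n], and
    quasi-polynomials that agree at all large integers are equal
    ([quasipoly_eventually_eq]). *)

(** * Properties that hold at all large integers *)

(** The bound is a natural number, so that a bound for finitely many properties
    is a [\max]. *)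
Definition eventually (A : int -> Prop) : Prop :=
  exists C : nat, forall n : int, C%:Z <= n -> A n.

Lemma eventually_and {A B : int -> Prop} : eventually A -> eventually B ->
  eventually (fun n => A n /\ B n).
Proof.
move=> [a Aa] [b Bb]; exists (maxn a b) => n le_n.
by split; [apply: Aa | apply: Bb]; lia.
Qed.

Lemma eventually_mono {A B : int -> Prop} : eventually A ->
  (forall n, A n -> B n) -> eventually B.
Proof. by move=> [a Aa] sAB; exists a => n /Aa /sAB. Qed.

Lemma eventually_nonempty {A : int -> Prop} : eventually A -> exists n, A n.
Proof. by move=> [a Aa]; exists a%:Z; apply: Aa. Qed.

Lemma int_residue {T : nat} (T0 : (0 < T)%N) (n : int) :
  exists (m : int) (i : 'I_T), n = T%:Z * m + i%:Z.
Proof.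
have TN0 : T%:Z != 0 by lia.
have lt_nT : (`|(n %% T%:Z)%Z| < T)%N.
  by have := modz_ge0 n TN0; have := ltz_pmod n (_ : 0 < T%:Z); lia.
exists (n %/ T%:Z)%Z, (Ordinal lt_nT).
by rewrite {1}(divz_eq n T%:Z) mulrC /= gez0_abs // modz_ge0.
Qed.

(** On each of the finitely many residue classes, [n = T m + i] is large exactly
    when [m] is. *)
Lemma eventually_represents {T : nat} {F : 'I_T -> {poly int}} {r : int -> int}
    (A : int -> Prop) : represents F r ->
  eventually (fun n => A (r n)) <-> forall i, eventually (fun m => A (F i).[m]).
Proof.
move=> [T0 Fr]; split=> [[C AC] i | AF].
  exists C => m le_m; rewrite -Fr; apply: AC.
  by nia.
have [C AC] := fin_all_exists AF.
(* [T m + i < T (m + 1)], so [n >= T (C + 1)] forces [m > C]. *)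
exists (T * (\max_i C i).+1)%N => n le_n.
have [m [i def_n]] := int_residue T0 n.
rewrite def_n Fr; apply: AC.
have leC : (C i <= \max_i C i)%N by exact: leq_bigmax.
have : (i < T)%N by [].
by nia.
Qed.

(** * Eventual signs of polynomials and quasi-polynomials *)

(** Horner's scheme drives the induction: once [p n >= 1], the value
    [p n * n + c] is at least [n + c]. *)
Lemma poly_eventually_gt0 {p : {poly int}} : 0 < lead_coef p ->
  eventually (fun n => 0 < p.[n]).
Proof.
have horner_step (x m b : int) : 0 < x -> `|b| < m -> 0 < x * m + b by nia.
elim/poly_ind: p => [|p c IHp]; first by rewrite lead_coef0.
have [-> | pN0] := eqVneq p 0.
  rewrite mul0r add0r lead_coefC => c_gt0.
  by exists 0%N => n _; rewrite hornerC.
rewrite lead_coefDl; last first.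
  by rewrite size_mulX // (leq_ltn_trans (size_polyC_leq1 c)) // ltnS size_poly_gt0.
rewrite lead_coefMX => /IHp [C pC].
exists (C + `|c|.+1)%N => n le_n; rewrite !hornerE.
by apply: horner_step; [apply: pC | ]; lia.
Qed.

Lemma poly_eventually_sgz (p : {poly int}) :
  eventually (fun n => sgz p.[n] = sgz (lead_coef p)).
Proof.
case: (ltrgt0P (lead_coef p)) => [p_gt0 | p_lt0 | /eqP].
- apply: eventually_mono (poly_eventually_gt0 p_gt0) _ => n pn_gt0.
  by rewrite !gtr0_sgz.
- have Np_gt0 : 0 < lead_coef (- p) by rewrite lead_coefN oppr_gt0.
  apply: eventually_mono (poly_eventually_gt0 Np_gt0) _ => n.
  by rewrite hornerN oppr_gt0 => pn_lt0; rewrite !ltr0_sgz.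
- by rewrite lead_coef_eq0 => /eqP->; exists 0%N => n _; rewrite horner0 lead_coef0.
Qed.

(** The sign of [p n] is constant for large [n].  With [0 <= x], [0 < x] and
    [x = 0] for [A x], this turns conditions on leading coefficients into
    conditions on large values. *)
Lemma poly_eventually_sgzE (A : pred int) (p : {poly int}) :
  eventually (fun n => A (sgz p.[n])) <-> A (sgz (lead_coef p)).
Proof.
split=> [Ap | Ap].
  by have [n [<-]] := eventually_nonempty (eventually_and (poly_eventually_sgz p) Ap).
by apply: eventually_mono (poly_eventually_sgz p) _ => n ->.
Qed.

Lemma qge0_eventually (r : quasipoly) : qge0 r <-> eventually (fun n => 0 <= r n).
Proof.
have [T [F Fr]] := asboolW (valP r).
rewrite (qge0_rep Fr) (eventually_represents (fun x => 0 <= x) Fr).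
have sgE (p : {poly int}) :
    (p = 0 \/ 0 < lead_coef p) <-> eventually (fun m => 0 <= p.[m]).
  have := poly_eventually_sgzE (fun x => 0 <= x) p.
  under [X in eventually X]eq_fun do rewrite sgz_ge0.
  move=> ->; rewrite sgz_ge0 le_eqVlt eq_sym lead_coef_eq0.
  by split=> [[/eqP->|->] | /orP[/eqP|]]; rewrite ?orbT; auto.
by split=> HF i; apply/sgE.
Qed.

Lemma qgt0_eventually (r : quasipoly) : qgt0 r <-> eventually (fun n => 0 < r n).
Proof.
have [T [F Fr]] := asboolW (valP r).
rewrite (qgt0_rep Fr) (eventually_represents (fun x => 0 < x) Fr).
have sgE (p : {poly int}) :
    (p != 0 /\ 0 < lead_coef p) <-> eventually (fun m => 0 < p.[m]).
  have := poly_eventually_sgzE (fun x => 0 < x) p.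
  under [X in eventually X]eq_fun do rewrite sgz_gt0.
  move=> ->; rewrite sgz_gt0 -lead_coef_eq0.
  by split=> [[] // | p_gt0]; rewrite gt_eqF.
by split=> HF i; apply/sgE.
Qed.

(** Each constituent of the difference vanishes at infinitely many points. *)
Lemma quasipoly_eventually_eq (r s : quasipoly) :
  eventually (fun n => r n = s n) -> r = s.
Proof.
move=> eq_rs; apply/eqP; rewrite -subr_eq0; apply/eqP.
have [T [F Fd]] := asboolW (valP (r - s)).
have d0 : eventually (fun n => (r - s) n = 0).
  apply: eventually_mono eq_rs _ => n eq_n.
  by have -> : (r - s) n = r n - s n by []; rewrite eq_n subrr.
have F0 i : F i = 0.
  have := (eventually_represents (fun x => x = 0) Fd).1 d0 i => F0i.
  apply/eqP; rewrite -lead_coef_eq0 -sgz_eq0.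
  apply/(poly_eventually_sgzE (fun x => x == 0)).
  by apply: eventually_mono F0i _ => m ->; rewrite sgz0.
apply/quasipolyP => n; have [m [i ->]] := int_residue Fd.1 n.
by rewrite Fd.2 F0 horner0.
Qed.

(** * Division of polynomial values *)

(** The term [rho] moves [c * h] by less than one step [h], so it can leave the
    range only from the extreme multiples [c = 0] and [c = T]; each of these is
    safe for one sign of [rho]. *)
Lemma digit_bound (T c h rho : int) : `|rho| < h -> (0 < c) || (0 <= rho) ->
  (c < T) || (rho < 0) -> 0 <= c <= T -> 0 <= c * h + rho < T * h.
Proof.
move=> lt_rho c_rho T_rho /andP[c_ge0 c_leT].
apply/andP; split.
  have [c0|cN0] := eqVneq c 0; first by rewrite c0 in c_rho *; lia.
  have : 0 <= (c - 1) * h by apply: mulr_ge0; lia.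
  by lia.
have [cT|cNT] := eqVneq c T; first by rewrite cT in T_rho *; lia.
have : 0 <= (T - 1 - c) * h by apply: mulr_ge0; lia.
by lia.
Qed.

(** As [s * g] is positive it equals [|g|], so [r] and [y * g + r] differ by less
    than [|g|]. *)
Lemma quotient_unique {s g y r : int} : `|s|%R = 1 ->
  0 <= y * g + r < s * g -> 0 <= r < s * g -> y = 0.
Proof.
move=> s1 yg_bd r_bd.
have abs_sg : `|s * g|%R = `|g|%R by rewrite normrM s1 mul1r.
have : `|y * g|%R < `|g|%R by rewrite -abs_sg; lia.
rewrite normrM => lt_yg.
have g_gt0 : 0 < `|g|%R :> int.
  by rewrite normr_gt0; apply: contraTneq lt_yg => ->; rewrite normr0 mulr0.
by move: lt_yg; rewrite gtr_pMl //; lia.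
Qed.

(** This is [T] dividing [q (T m + i) - q i], with a quotient that is a
    polynomial in [m]: it makes [q] modulo [T] periodic and its integer quotient
    by [T] a polynomial on each residue class. *)
Lemma poly_residue (q : {poly int}) (T : nat) (i : int) :
  exists Q : {poly int}, forall m, q.[T%:Z * m + i] = Q.[m] * T%:Z + q.[i].
Proof.
elim/poly_ind: q => [|q c [Q eqQ]]; first by exists 0 => m; rewrite !hornerE.
exists (Q * (T%:Z *: 'X + i%:P) + q.[i] *: 'X) => m.
by rewrite !(hornerMXaddC, hornerD, hornerM, hornerZ, hornerX, hornerC) eqQ; ring.
Qed.

Lemma is_quasi_poly_divz (q : {poly int}) (T : nat) : (0 < T)%N ->
  is_quasi_poly (fun n => (q.[n] %/ T%:Z)%Z).
Proof.
move=> T0; have [Q eqQ] := choice (fun i : 'I_T => poly_residue q T i%:Z).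
exists T, (fun i => Q i + (q.[i%:Z] %/ T%:Z)%Z%:P); split=> // m i.
by rewrite eqQ divzMDl ?hornerE //; lia.
Qed.

Lemma poly_eventually_lt {p h : {poly int}} :
  0 < lead_coef h -> (size p < size h)%N -> eventually (fun n => `|p.[n]| < h.[n]).
Proof.
move=> h_gt0 lt_ph.
have hD_gt0 : 0 < lead_coef (h + p) by rewrite lead_coefDl.
have hB_gt0 : 0 < lead_coef (h - p) by rewrite lead_coefDl // size_polyN.
apply: eventually_mono (eventually_and (poly_eventually_gt0 hD_gt0)
                                       (poly_eventually_gt0 hB_gt0)) _ => n.
rewrite !hornerD hornerN subr_gt0 -ltrBlDr sub0r => -[lt_Np lt_p].
by rewrite ltr_norml ltrNl lt_Np.
Qed.

(** In [q n = T * P n + c n] the digit [c n] must be positive when [rho] is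
    eventually negative and less than [T] otherwise.  Dividing [q n - e] by [T],
    with [e = 1] in the first case and [e = 0] in the second, leaves a remainder
    [d] between [0] and [T - 1], and [c n = d + e]. *)
Lemma quasipoly_division (f h : {poly int}) : 0 < lead_coef h ->
  exists P : quasipoly, eventually (fun n => 0 <= f.[n] - P n * h.[n] < h.[n]).
Proof.
move=> h_gt0; have hN0 : h != 0 by rewrite -lead_coef_eq0 gt_eqF.
have := Pdiv.Idomain.divp_eq f h; have := ltn_modpN0 f hN0.
set q := f %/ h; set rho := f %% h; move: (scalp f h) => k lt_rho eq_f.
have a_gt0 : 0 < lead_coef h ^+ k by rewrite exprn_gt0.
have [T def_T] : exists T : nat, lead_coef h ^+ k = T%:Z.
  by exists `|lead_coef h ^+ k|%N; rewrite gtz0_abs.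
rewrite def_T in eq_f a_gt0.
pose e : int := if lead_coef rho < 0 then 1 else 0.
have T0 : (0 < T)%N by [].
exists (QuasiPoly (asboolT (is_quasi_poly_divz (q - e%:P) T T0))).
apply: eventually_mono (eventually_and (poly_eventually_lt h_gt0 lt_rho)
                                       (poly_eventually_sgz rho)) _ => n [lt_n sg_n] /=.
have rho_lt0 : (rho.[n] < 0) = (lead_coef rho < 0) by rewrite -sgz_lt0 sg_n sgz_lt0.
have := congr1 (horner^~ n) eq_f; rewrite !hornerE => eq_fn.
set P := (_ %/ _)%Z.
have TN0 : T%:Z != 0 by rewrite gt_eqF.
have := divz_eq (q.[n] - e) T%:Z; rewrite -/P.
have := modz_ge0 (q.[n] - e) TN0; have := ltz_pmod (q.[n] - e) a_gt0.
set d := (_ %% _)%Z => d_ltT d_ge0 eq_q.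
have eq_r : T%:Z * (f.[n] - P * h.[n]) = (d + e) * h.[n] + rho.[n].
  have -> : d + e = q.[n] - P * T%:Z by lia.
  by rewrite mulrBr eq_fn; ring.
have /andP[r_ge0 r_lt] : 0 <= (d + e) * h.[n] + rho.[n] < T%:Z * h.[n].
  by apply: digit_bound => //; move: rho_lt0; rewrite /e; case: ifP; lia.
rewrite -eq_r in r_ge0 r_lt.
by rewrite -(pmulr_rge0 _ a_gt0) r_ge0 -(ltr_pM2l a_gt0) r_lt.
Qed.

(** * Quotient and remainder *)

(** The division is by [|g|]; its quotient is multiplied by the sign of [g]. *)
Theorem theorem12 (f g : {poly int}) (hg : g <> 0) :
  exists! Pr : quasipoly * quasipoly,
    f%:QP = Pr.1 * g%:QP + Pr.2 /\
    qle 0 Pr.2 /\ qlt Pr.2 (poly_abs g)%:QP.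
Proof.
set h := poly_abs g; set s := sgz (lead_coef g).
have lgN0 : lead_coef g != 0 by rewrite lead_coef_eq0; apply/eqP.
have def_h : h = s *: g by exact: poly_absE.
have h_gt0 : 0 < lead_coef h.
  by rewrite def_h lead_coefZ -sgz_gt0 sgzM sgz_id mulz_sg lgN0.
have remP (r : quasipoly) : qle 0 r /\ qlt r h%:QP <->
    eventually (fun n => 0 <= r n < h.[n]).
  rewrite /qle /qlt subr0 qge0_eventually qgt0_eventually.
  split=> [[r_ge0 r_lt] | r_bd].
    apply: eventually_mono (eventually_and r_ge0 r_lt) _ => n [-> /=].
    by rewrite subr_gt0.
  split; apply: eventually_mono r_bd _ => n /andP[] //=.
  by rewrite subr_gt0.
have [P P_bd] := quasipoly_division f h h_gt0.
have def_hn n : h.[n] = s * g.[n] by rewrite def_h hornerZ.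
pose P' : quasipoly := P * (s%:P)%:QP.
exists (P', f%:QP - P' * g%:QP); split=> [|[P1 r1] /= [eq_f /remP r1_bd]].
  split; first by rewrite addrC subrK.
  apply/remP; apply: eventually_mono P_bd _ => n.
  suff -> : (f%:QP - P' * g%:QP) n = f.[n] - P n * h.[n] by [].
  by rewrite def_hn mulrA -[s in RHS](hornerC s n).
suff def_P1 : P1 = P' by rewrite -def_P1 eq_f addrAC subrr add0r.
apply: quasipoly_eventually_eq.
apply: eventually_mono (eventually_and P_bd r1_bd) _ => n [].
have -> : P' n = P n * s by rewrite -[s in RHS](hornerC s n).
have : f.[n] = P1 n * g.[n] + r1 n by rewrite -[f.[n]]/(f%:QP n) eq_f.
rewrite def_hn => -> r_bd r1n_bd.
apply/eqP; rewrite -subr_eq0; apply/eqP.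
apply: quotient_unique r1n_bd; first by rewrite normr_sgz lgN0.
by rewrite mulrBl addrAC -mulrA.
Qed.
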